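(* Assume the inhomogeneities satisfy $\xi_i\neq\xi_j \bmod \eta$ for all $i\ne j$ in $\{1,\dots,N\}$, and that the $2\times 2$ twist matrix $K$ is not proportional to the identity. Then the spectral problem of $\mathsf T^{(K)}(\lambda)$ admits Sklyanin-like separate variable representations. In detail: a) If $K_{12}\neq0$ (respectively $K_{21}\ne0$), then $\mathsf B^{(K)}(\lambda)$ (respectively $\mathsf C^{(K)}(\lambda)$) is diagonalizable with simple spectrum, and the quantum separate variables are generated by the zeros of $\mathsf B^{(K)}$ (respectively $\mathsf C^{(K)}$). b) If $K_{12}=0$, let $W$ be an invertible $2\times2$ matrix such that $\bar K=W^{-1}KW$ has $\bar K_{12}\ne0$ and $\bar K_{21}\neq 0$, and let $\mathcal W$ be the induced operator on $\mathcal H$. Then $$\tilde{\mathsf B}^{(K)}(\lambda)=\mathrm{tr}_0\Big[W_0\begin{pmatrix}0&0\\1&0\end{pmatrix}_0W_0^{-1}\mathsf M_0^{(K)}(\lambda)\Big]=\mathcal W\,\mathsf B^{(\bar K)}(\lambda)\,\mathcal W^{-1}$$ is diagonalizable with simple spectrum, and the quantum separate variables are generated by the zeros of $\tilde{\mathsf B}^{(K)}$. c) If $K_{21}=0$, with $W,\bar K,\mathcal W$ chosen in the same way ($\bar K=W^{-1}KW$, $\bar K_{12}\neq0$, $\bar K_{21}\ne0$), then $$\tilde{\mathsf C}^{(K)}(\lambda)=\mathrm{tr}_0\Big[W_0\begin{pmatrix}0&1\\0&0\end{pmatrix}_0W_0^{-1}\mathsf M_0^{(K)}(\lambda)\Big]=\mathcal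 W\,\mathsf C^{(\bar K)}(\lambda)\,\mathcal W^{-1}$$ is diagonalizable with simple spectrum, and the quantum separate variables are generated by the zeros of $\tilde{\mathsf C}^{(K)}$.
   Context: Setting. Let $\eta\in\mathbb{C}\setminus\{0\}$, $N\ge1$, and let $s_1,\dots,s_N$ be spins with $2s_n\in\mathbb{Z}_{>0}$. Let $V_n=\mathbb{C}^{2s_n+1}$ and $\mathcal H=\bigotimes_{n=1}^N V_n$. On $V_n$ let $S_n^z=\mathrm{diag}(s_n,s_n-1,\dots,-s_n)$, let $S_n^+$ be the matrix with only nonzero entries $(S_n^+)_{j,j+1}=\sqrt{j(2s_n+1-j)}$, $1\le j\le 2s_n$, and let $S_n^-=(S_n^+)^t$. With auxiliary space $V_0=\mathbb{C}^2$, the Lax operator is $$\mathsf L_{0n}(\lambda)=\begin{pmatrix}\lambda+\eta(\tfrac12+S_n^z)&\eta S_n^-\\ \eta S_n^+&\lambda+\eta(\tfrac12-S_n^z)\end{pmatrix}_{[0]}.$$ For a $2\times2$ matrix $K=(K_{ij})$ and inhomogeneities $\xi_1,\dots,\xi_N\in\mathbb{C}$, the monodromy matrix is $$\mathsf M_0^{(K)}(\lambda)=K_0\mathsf L_{0N}(\lambda-\xi_N)\cdots\mathsf L_{01}(\lambda-\xi_1)=\begin{pmatrix}\mathsf A^{(K)}(\lambda)&\mathsf B^{(K)}(\lambda)\\\mathsf C^{(K)}(\lambda)&\mathsf D^{(K)}(\lambda)\end{pmatrix}_{[0]},$$ with entries in $\mathrm{End}(\mathcal H)$, and the transfer matrix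 is $\mathsf T^{(K)}(\lambda)=\mathrm{tr}_0\mathsf M_0^{(K)}(\lambda)$. Each of the families $\mathsf B^{(K)}(\lambda)$, $\mathsf C^{(K)}(\lambda)$ is commuting: $[\mathsf B^{(K)}(\lambda),\mathsf B^{(K)}(\mu)]=0$, and similarly for $\mathsf C^{(K)}$. For $K$ not proportional to the identity, a matrix $W$ as in b), c) exists. Induced operator. For an invertible $2\times2$ matrix $W$, $\mathcal W=\bigotimes_{n=1}^NW_n$, where $W_n$ is the action of $W^{\otimes 2s_n}$ on symmetric tensors $\mathrm{Sym}^{2s_n}(\mathbb{C}^2)$, identified with $V_n$ as the spin-$s_n$ representation (the $j$-th basis vector of $V_n$ corresponds to the normalized symmetric tensor with $2s_n+1-j$ factors $e_1$ and $j-1$ factors $e_2$). Terminology. A commuting polynomial operator family is ''diagonalizable with simple spectrum'' if it has a common eigenbasis and distinct basis elements have distinct eigenvalue functions of $\lambda$. ''The quantum separate variables are generated by the zeros of $\mathsf X(\lambda)$'' means: there are pairwise commuting, simultaneously diagonalizable operators $Y_1,\dots,Y_N$ and a nonzero constant $x$ with $\mathsf X(\lambda)=x\prod_{n=1}^N(\lambda-Y_n)$, and the separate-variable basis is their common eigenbasis.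
   Formalization: Added hypothesis: ξ_i ≠ ξ_j + η/2 mod η whenever s_i − s_j is not an integer; without it the claim fails, e.g. N=2, s_1=1/2, s_2=1, ξ_1=ξ_2+η/2, K=[[0,1],[1,0]], where B^(K) is not diagonalizable. *)

(* Defs.v *)
From mathcomp Require Import all_boot all_order all_algebra.
From mathcomp Require Import reals complex.

Set Implicit Arguments.
Unset Strict Implicit.
Unset Printing Implicit Defensive.

Import Order.TTheory GRing.Theory Num.Theory.

Local Open Scope ring_scope.

(* Spins are encoded by the naturals [d n = 2 s_n], so that V_n = C^(d n).+1,
   and indices (of sites, basis vectors, matrix entries) start at 0. *)

(* ---- Tensor products ---- *)

(* The canonical basis of \bigotimes_n C^(d n).+1 consists of the tensors
   e_(f 0) \otimes ... \otimes e_(f (N-1)), for [f] in the following type;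
   operators are matrices indexed through [enum_val], acting on columns. *)
Definition tensor_index (N : nat) (d : 'I_N -> nat) :=
  {dffun forall n : 'I_N, 'I_(d n).+1}.

Definition tensor_dim (N : nat) (d : 'I_N -> nat) : nat := #|tensor_index d|.

Definition tensor_op (F : comNzRingType) (N : nat) (d : 'I_N -> nat)
    (A : forall n : 'I_N, 'M[F]_((d n).+1)) : 'M[F]_(tensor_dim d) :=
  \matrix_(a, b) \prod_(n < N)
    A n ((enum_val a : tensor_index d) n) ((enum_val b : tensor_index d) n).

Definition site_op (F : comNzRingType) (N : nat) (d : 'I_N -> nat) (n : 'I_N)
    (A : 'M[F]_((d n).+1)) : 'M[F]_(tensor_dim d) :=
  tensor_op (dfwith (fun m : 'I_N => 1%:M : 'M[F]_((d m).+1)) A).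

Section XXX.

Context {R : realType}.
Local Notation C := R[i].

(* ---- Spin operators on C^t.+1, with t = 2 s ---- *)

Definition spin_z (t : nat) : 'M[C]_t.+1 :=
  diag_mx (\row_(j < t.+1) (t%:R / 2 - j%:R)).

(* sqrt (j (2 s + 1 - j)) with j = i + 1 *)
Definition spin_plus (t : nat) : 'M[C]_t.+1 :=
  \matrix_(i, k) (if k == i.+1 :> nat then sqrtC ((i.+1 * (t - i))%N%:R : C) else 0).

Definition spin_minus (t : nat) : 'M[C]_t.+1 := (spin_plus t)^T.

(* ---- Monodromy matrix: a 2 x 2 matrix (auxiliary space) over End(H) ---- *)

Definition mx22 (T : Type) (a b c d : T) : 'M[T]_2 :=
  \matrix_(i, j) (if i == 0 then (if j == 0 then a else b)
                  else (if j == 0 then c else d)).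

Definition aux (m : nat) (K : 'M[C]_2) : 'M['M[C]_m]_2 :=
  map_mx (fun c : C => c%:M) K.

Definition lax (N : nat) (d : 'I_N -> nat) (eta : C) (n : 'I_N) (lam : C) :
    'M['M[C]_(tensor_dim d)]_2 :=
  mx22 (site_op ((lam + eta / 2)%:M + eta *: spin_z (d n)))
       (site_op (eta *: spin_minus (d n)))
       (site_op (eta *: spin_plus (d n)))
       (site_op ((lam + eta / 2)%:M - eta *: spin_z (d n))).

Definition monodromy (N : nat) (d : 'I_N -> nat) (eta : C) (xi : 'I_N -> C)
    (K : 'M[C]_2) (lam : C) : 'M['M[C]_(tensor_dim d)]_2 :=
  aux (tensor_dim d) K *m
  \big[mulmx/1%:M]_(n < N) lax d eta (rev_ord n) (lam - xi (rev_ord n)).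

Definition B_op (N : nat) (d : 'I_N -> nat) (eta : C) (xi : 'I_N -> C)
    (K : 'M[C]_2) (lam : C) : 'M[C]_(tensor_dim d) :=
  monodromy d eta xi K lam 0 1.

Definition C_op (N : nat) (d : 'I_N -> nat) (eta : C) (xi : 'I_N -> C)
    (K : 'M[C]_2) (lam : C) : 'M[C]_(tensor_dim d) :=
  monodromy d eta xi K lam 1 0.

(* tr_0 (W_0 E_0 W_0^-1 M_0^(K)(lam)) *)
Definition rotated_op (N : nat) (d : 'I_N -> nat) (eta : C) (xi : 'I_N -> C)
    (W E K : 'M[C]_2) (lam : C) : 'M[C]_(tensor_dim d) :=
  \tr (aux (tensor_dim d) W *m aux (tensor_dim d) E *m
       aux (tensor_dim d) (invmx W) *m monodromy d eta xi K lam).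

Definition Btilde_op (N : nat) (d : 'I_N -> nat) (eta : C) (xi : 'I_N -> C)
    (W K : 'M[C]_2) (lam : C) : 'M[C]_(tensor_dim d) :=
  rotated_op d eta xi W (mx22 0 0 1 0) K lam.

Definition Ctilde_op (N : nat) (d : 'I_N -> nat) (eta : C) (xi : 'I_N -> C)
    (W K : 'M[C]_2) (lam : C) : 'M[C]_(tensor_dim d) :=
  rotated_op d eta xi W (mx22 0 1 0 0) K lam.

(* ---- Induced operator ---- *)

(* Column [j] is the normalized symmetric tensor of (C^2)^{\otimes t} with
   t - j factors e_1 and j factors e_2: the sum of the 'C(t, j) basis tensors
   of that content, divided by sqrt 'C(t, j). *)
Definition sym_basis (t : nat) :
    'M[C]_(tensor_dim (fun _ : 'I_t => 1%N), t.+1) :=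
  \matrix_(a, j)
    (if #|[set k : 'I_t |
            (enum_val a : tensor_index (fun _ : 'I_t => 1%N)) k == 1]| == j
     then (sqrtC ('C(t, j)%:R : C))^-1 else 0).

(* The columns of [sym_basis t] are a real orthonormal basis of Sym^t(C^2),
   which W^{\otimes t} preserves; hence this is the matrix of the restriction
   of W^{\otimes t} to Sym^t(C^2) in that basis. *)
Definition sym_power (t : nat) (W : 'M[C]_2) : 'M[C]_t.+1 :=
  (sym_basis t)^T *m tensor_op (fun _ : 'I_t => W) *m sym_basis t.

Definition induced_op (N : nat) (d : 'I_N -> nat) (W : 'M[C]_2) :
    'M[C]_(tensor_dim d) :=
  tensor_op (fun n : 'I_N => sym_power (d n) W).

Definition admissible_rotation (K W : 'M[C]_2) : Prop :=
  [/\ W \in unitmx, (invmx W *m K *m W) 0 1 != 0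
    & (invmx W *m K *m W) 1 0 != 0].

(* ---- Separation of variables ---- *)

(* The columns of P form a basis of common eigenvectors of the family X;
   [ev j] is the eigenvalue function of the j-th one. *)
Definition common_eigenbasis (T : Type) (m : nat) (X : T -> 'M[C]_m)
    (P : 'M[C]_m) (ev : 'I_m -> T -> C) : Prop :=
  P \in unitmx /\ forall j t, X t *m col j P = ev j t *: col j P.

Definition diagonalizable_simple (m : nat) (X : C -> 'M[C]_m) : Prop :=
  exists (P : 'M[C]_m) (ev : 'I_m -> C -> C),
    common_eigenbasis X P ev /\ (forall i j, ev i =1 ev j -> i = j).

(* The basis of the separate variables is the common eigenbasis P of the Y n. *)
Definition separate_variables_from_zeros (N m : nat) (X : C -> 'M[C]_m) :
    Prop :=
  exists (Y : 'I_N -> 'M[C]_m) (x : C) (P : 'M[C]_m) (y : 'I_m -> 'I_N -> C),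
    [/\ x != 0,
        forall n k, comm_mx (Y n) (Y k),
        common_eigenbasis Y P y
      & forall lam, X lam = x *: \big[mulmx/1%:M]_(n < N) (lam%:M - Y n)].

Definition sklyanin_sov (N m : nat) (X : C -> 'M[C]_m) : Prop :=
  diagonalizable_simple X /\ separate_variables_from_zeros N X.

(* ---- Genericity of the inhomogeneities ---- *)

Definition neq_mod (eta x y : C) : Prop := forall k : int, x - y != k%:~R * eta.

(* The zeros attached to site n form a ladder in
   xi_n + eta (s_n - 1/2) + eta Z. If s_i - s_j is not an integer, then
   xi_i <> xi_j mod eta does not separate the ladders of the sites i and j:
   for s = (1/2, 1), K = [[0,1],[1,0]] and xi_1 - xi_2 = eta / 2, the operators
   B^(K)(lam) are not diagonalizable. For such pairs one also needs
   xi_i <> xi_j + eta / 2 mod eta. The condition below is void when all spins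
   are integers, or all are half-integers. *)
Definition mixed_spins_generic (N : nat) (d : 'I_N -> nat) (eta : C)
    (xi : 'I_N -> C) : Prop :=
  forall i j, odd (d i + d j) -> neq_mod eta (xi i) (xi j + eta / 2).

End XXX.

(* Main.v *)
Require Import Defs.
From mathcomp Require Import all_boot all_order all_algebra.
From mathcomp Require Import reals complex.
From mathcomp Require Import fingroup perm boolp ring.

Set Implicit Arguments.
Unset Strict Implicit.
Unset Printing Implicit Defensive.

Import Order.TTheory GRing.Theory Num.Theory.

Local Open Scope ring_scope.

(* Write M for the untwisted monodromy matrix. Each of the operators in the
   theorem is u M w for a row u and a column w of scalars with c = u.w <> 0. Since
   W_0 (induced W) commutes with M, choosing W with W e_2 = w and u W = (0, c)
   shows that u M w is conjugate to c times the entry D of M, whatever the twist.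
   In the canonical basis, ordered by sum_n n f(n), D is triangular: in each
   off-diagonal term every S^+ is followed by an S^- at a lower site. Its diagonal
   entries are prod_n (lam - z_(n, f(n))), where z_(n, j) runs through the ladder
   of the site n; the ladders are disjoint by genericity, so that these functions
   are distinct. As the D(lam) commute (RTT relation), a member of the family with
   simple spectrum diagonalizes all of them. *)

(** * Tensor product operators *)

Lemma ord2_eq (i : 'I_2) : i = 0 \/ i = 1.
Proof. by case: i => [[|[|//]]] ?; [left | right]; apply: val_inj. Qed.

(** Each inner sum becomes a sum over the tagged union of the [T_ i], one type for all factors;
    non-dependent distributivity applies there, and [fprod] leads back. *)
Lemma bigA_distr_dffun (R : comNzRingType) (I : finType) (T_ : I -> finType)
    (F : forall i, T_ i -> R) :
  \prod_i \sum_(j : T_ i) F i j =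
  \sum_(f : {dffun forall i, T_ i}) \prod_i F i (f i).
Proof.
rewrite (reindex (@dffun_of_fprod I T_)); last exact/onW_bij/dffun_of_fprod_bij.
under eq_bigr => i _ do rewrite (big_tag F).
rewrite bigA_distr_big_dep.
transitivity (\sum_(t : fprod T_) \prod_i [ffun x => F i x] (t i)).
  rewrite big_fprod; apply: eq_bigr => g _; apply: eq_bigr => i _.
  rewrite /untag; case: eqP => // e; by rewrite ffunE.
by apply: eq_bigr => f _; apply: eq_bigr => i _; rewrite !ffunE.
Qed.

Section TensorOp.
Variables (F : comNzRingType) (N : nat) (d : 'I_N -> nat).
Implicit Types A B : forall n : 'I_N, 'M[F]_((d n).+1).

Lemma eq_tensor_op A B : (forall n, A n = B n) -> tensor_op A = tensor_op B.
Proof.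
by move=> AB; apply/matrixP => a b; rewrite !mxE; under eq_bigr do rewrite AB.
Qed.

Lemma tensor_opM A B :
  tensor_op A *m tensor_op B = tensor_op (fun n => A n *m B n).
Proof.
apply/matrixP => a b; rewrite !mxE.
under [RHS]eq_bigr do rewrite mxE.
rewrite bigA_distr_dffun (reindex (@enum_val (tensor_index d) predT)) /=; last first.
  exact/onW_bij/enum_val_bij.
by apply: eq_bigr => c _; rewrite !mxE -big_split.
Qed.

Lemma prod_natr_bool (T : finType) (P : pred T) :
  \prod_i (P i)%:R = [forall i, P i]%:R :> F.
Proof.
case: (boolP [forall _, _]) => [/forallP PT|].
  by rewrite big1 // => i _; rewrite PT.
rewrite negb_forall => /existsP [i /negbTE Pi].
by rewrite (bigD1 i) //= Pi mul0r.
Qed.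

Lemma tensor_op1 : tensor_op (fun n : 'I_N => 1%:M : 'M[F]_((d n).+1)) = 1%:M.
Proof.
apply/matrixP => a b; rewrite !mxE.
under eq_bigr do rewrite mxE.
rewrite prod_natr_bool -(inj_eq enum_val_inj); congr (nat_of_bool _)%:R.
apply/forallP/eqP => [E|-> //]; apply/ffunP => n; exact/eqP/E.
Qed.

Lemma site_opE (n : 'I_N) (A : 'M[F]_((d n).+1)) a b :
  site_op A a b =
  A ((enum_val a : tensor_index d) n) ((enum_val b : tensor_index d) n) *
  [forall m, (m != n) ==>
     ((enum_val a : tensor_index d) m == (enum_val b : tensor_index d) m)]%:R.
Proof.
rewrite mxE (bigD1 n) //= dfwith_in; congr (_ * _).
rewrite -prod_natr_bool [RHS](bigD1 n) //= eqxx /= mul1r; apply: eq_bigr => m mn.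
by rewrite mn dfwith_out ?mxE // eq_sym.
Qed.

Lemma site_op_semilinear (n : 'I_N) c (A B : 'M[F]_((d n).+1)) :
  site_op (c *: A + B) = c *: site_op A + site_op B.
Proof.
apply/matrixP => a b.
by rewrite [RHS]mxE [(c *: site_op A) a b]mxE !site_opE !mxE mulrDl mulrA.
Qed.

Lemma site_opD (n : 'I_N) (A B : 'M[F]_((d n).+1)) :
  site_op (A + B) = site_op A + site_op B.
Proof. by rewrite -[A]scale1r site_op_semilinear !scale1r. Qed.

Lemma site_op0 (n : 'I_N) : site_op (0 : 'M[F]_((d n).+1)) = 0.
Proof.
have := @site_opD n 0 0; rewrite addr0 => /eqP.
by rewrite -subr_eq subrr => /eqP.
Qed.

Lemma site_opZ (n : 'I_N) c (A : 'M[F]_((d n).+1)) :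
  site_op (c *: A) = c *: site_op A.
Proof. by rewrite -[c *: A]addr0 site_op_semilinear site_op0 addr0. Qed.

Lemma site_opB (n : 'I_N) (A B : 'M[F]_((d n).+1)) :
  site_op (A - B) = site_op A - site_op B.
Proof. by rewrite -scaleN1r addrC site_op_semilinear addrC scaleN1r. Qed.

Lemma site_op_sum (n : 'I_N) I r (P : pred I) (A : I -> 'M[F]_((d n).+1)) :
  site_op (\sum_(i <- r | P i) A i) = \sum_(i <- r | P i) site_op (A i).
Proof. exact: (big_morph _ (@site_opD n) (site_op0 n)). Qed.

Lemma site_opM (n : 'I_N) (A B : 'M[F]_((d n).+1)) :
  site_op (A *m B) = site_op A *m site_op B.
Proof.
rewrite /site_op tensor_opM; apply: eq_tensor_op => m.
have [E|nm] := eqVneq n m; last by rewrite !dfwith_out // mulmx1.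
by case: m / E; rewrite !dfwith_in.
Qed.

Lemma site_op1 (n : 'I_N) : site_op (1%:M : 'M[F]_((d n).+1)) = 1%:M.
Proof.
rewrite -[RHS]tensor_op1; apply: eq_tensor_op => m.
have [E|nm] := eqVneq n m; last by rewrite dfwith_out.
by case: m / E; rewrite dfwith_in.
Qed.

Lemma site_op_scalar (n : 'I_N) c : site_op (c%:M : 'M[F]_((d n).+1)) = c%:M.
Proof. by rewrite -scalemx1 site_opZ site_op1 scalemx1. Qed.

Lemma site_op_comm (n m : 'I_N) (A : 'M[F]_((d n).+1)) (B : 'M[F]_((d m).+1)) :
  n != m -> site_op A *m site_op B = site_op B *m site_op A.
Proof.
move=> nm; rewrite /site_op !tensor_opM; apply: eq_tensor_op => k.
have [E|nk] := eqVneq n k.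
  by case: k / E; rewrite dfwith_in dfwith_out ?mulmx1 ?mul1mx // eq_sym.
by rewrite !(dfwith_out _ _ nk) mulmx1 mul1mx.
Qed.

Lemma tensor_op_site (n : 'I_N) (W : forall m : 'I_N, 'M[F]_((d m).+1))
    (A A' : 'M[F]_((d n).+1)) :
  W n *m A = A' *m W n -> tensor_op W *m site_op A = site_op A' *m tensor_op W.
Proof.
move=> WA; rewrite /site_op !tensor_opM; apply: eq_tensor_op => m.
have [E|nm] := eqVneq n m; last by rewrite !dfwith_out // mulmx1 mul1mx.
by case: m / E; rewrite !dfwith_in.
Qed.

End TensorOp.

(** * Symmetric tensors and spin matrices *)

Section SymmetricTensors.
Context {R : realType}.
Variable t : nat.
Local Notation C := R[i].
Local Notation chain := (fun _ : 'I_t => 1%N).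
Local Notation qubits := (tensor_index chain).
Local Notation dim := (tensor_dim chain).

Implicit Types f : qubits.

Definition content (f : qubits) : nat := #|[set k | f k == 1]|.

Lemma content_le f : (content f <= t)%N.
Proof. by rewrite -[X in (_ <= X)%N]card_ord max_card. Qed.

Lemma card_content0 f : #|[set k | f k == 0]| = (t - content f)%N.
Proof.
have := cardsC [set k | f k == 1]; rewrite card_ord -/(content f) => E.
rewrite -[in RHS]E addKn; apply: eq_card => k; rewrite !inE.
by case: (f k) => [[|[|[]]]].
Qed.

Lemma prod_content (S : comNzRingType) (p : 'I_2 -> S) f :
  \prod_k p (f k) = p 0 ^+ (t - content f) * p 1 ^+ content f.
Proof.
rewrite (bigID (fun k => f k == 0)) /= -card_content0; congr (_ * _).
  by rewrite -prodr_const; apply: eq_big => [k|k /eqP ->//]; rewrite inE.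
rewrite -prodr_const; apply: eq_big => [k|k]; rewrite ?inE;
  by case: (f k) => [[|[|[]]]] // *; congr p; apply: val_inj.
Qed.

Lemma sum_qubits (S : comNzRingType) (w : 'I_t -> 'I_2 -> S) :
  \sum_(a < dim) \prod_k w k ((enum_val a : qubits) k) = \prod_k \sum_i w k i.
Proof.
rewrite bigA_distr_dffun (reindex (@enum_val qubits predT)) //=.
exact/onW_bij/enum_val_bij.
Qed.

(** Generating function: each factor in state 1 contributes an X, so the coefficient of X^j selects
    the basis tensors of content j. *)
Lemma sum_content_coef (S : comNzRingType) (w : 'I_t -> 'I_2 -> S) j :
  \sum_(a < dim) \prod_k w k ((enum_val a : qubits) k) *
    (content (enum_val a) == j)%:R =
  (\prod_k \sum_i (w k i)%:P * 'X^i)`_j.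
Proof.
rewrite -sum_qubits coef_sum; apply: eq_bigr => a _.
rewrite big_split /= (prod_content (fun i : 'I_2 => 'X^i)) /= expr1n mul1r.
by rewrite -rmorph_prod /= coefCM expr1 coefXn eq_sym.
Qed.

(** With all weights 1 the generating function above is (1 + X)^t. *)
Lemma card_content j :
  \sum_(a < dim) (content (enum_val a) == j)%:R = 'C(t, j)%:R :> C.
Proof.
transitivity ((('X : {poly C}) + 1) ^+ t)`_j; last first.
  rewrite addrC exprDn coef_sum; under eq_bigr => i _.
    rewrite expr1n mul1r coefMn coefXn; over.
  case: (ltnP j t.+1) => jt.
    rewrite (bigD1 (Ordinal jt)) //= eqxx big1 ?addr0 // => i.
    by rewrite -val_eqE /= eq_sym => /negbTE ->; rewrite mul0rn.
  rewrite bin_small // big1 // => i _.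
  by rewrite gtn_eqF ?mul0rn // (leq_trans _ jt).
transitivity (\sum_(a < dim) \prod_(k < t) (1 : C) *
    (content (enum_val a) == j)%:R).
  by apply: eq_bigr => a _; rewrite big1 // mul1r.
rewrite (sum_content_coef (fun _ _ => 1)); congr (_`_j).
rewrite prodr_const card_ord big_ord_recl big_ord1.
by rewrite !mul1r addrC expr0 expr1.
Qed.

Definition sym_norm j : C := (sqrtC ('C(t, j)%:R))^-1.

Lemma sym_norm_neq0 j : (j <= t)%N -> sym_norm j != 0.
Proof. by move=> jt; rewrite invr_eq0 sqrtC_eq0 pnatr_eq0 -lt0n bin_gt0. Qed.

Lemma sym_basisE a (j : 'I_t.+1) :
  sym_basis t a j = (content (enum_val a) == j)%:R * sym_norm j :> C.
Proof. by rewrite mxE; case: eqP; rewrite ?mul1r ?mul0r. Qed.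

Lemma sym_basis_orthonormal : (sym_basis t)^T *m sym_basis t = 1%:M :> 'M[C]_t.+1.
Proof.
apply/matrixP => i j; rewrite !mxE; under eq_bigr => a _ do rewrite mxE !sym_basisE.
case: (eqVneq i j) => [<-|ij].
  transitivity (\sum_(a < dim) (content (enum_val a) == i)%:R * (sym_norm i) ^+ 2).
    by apply: eq_bigr => a _; case: eqP; rewrite ?mul1r ?mul0r.
  rewrite -mulr_suml card_content exprVn sqrtCK mulfV //.
  by rewrite pnatr_eq0 -lt0n bin_gt0 -ltnS.
rewrite big1 // => a _; case: eqP => [->|]; rewrite ?mul0r //.
by rewrite val_eqE (negbTE ij) mul0r mulr0.
Qed.

(** A column that depends on the basis tensor through its content only is symmetric; [sym_norm]
    enters inversely to undo the normalization. *)
Lemma sym_basis_span p (M : 'M[C]_(dim, p)) (phi : nat -> 'I_p -> C) :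
  (forall a k, M a k = phi (content (enum_val a)) k) ->
  M = sym_basis t *m \matrix_(j, k) ((sym_norm j)^-1 * phi j k).
Proof.
move=> E; apply/matrixP => a k; rewrite E mxE.
have lt : (content (enum_val a) < t.+1)%N by rewrite ltnS content_le.
rewrite (bigD1 (Ordinal lt)) //= big1 ?addr0 => [|j]; rewrite sym_basisE mxE /=.
  by rewrite eqxx mul1r mulrA divff ?mul1r // sym_norm_neq0 // content_le.
by rewrite -val_eqE /= eq_sym => /negbTE ->; rewrite !mul0r.
Qed.

Lemma tensor_op_sym_basis (W : 'M[C]_2) :
  sym_basis t *m ((sym_basis t)^T *m (tensor_op (fun _ : 'I_t => W) *m sym_basis t))
  = tensor_op (fun _ : 'I_t => W) *m sym_basis t.
Proof.
pose p i : {poly C} := \sum_k (W i k)%:P * 'X^k.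
pose phi c (k : 'I_t.+1) := sym_norm k * (p 0 ^+ (t - c) * p 1 ^+ c)`_k.
have E a k : (tensor_op (fun _ : 'I_t => W) *m sym_basis t) a k =
    phi (content (enum_val a)) k.
  rewrite /phi -prod_content mxE.
  rewrite -(sum_content_coef (fun l i => W ((enum_val a : qubits) l) i)).
  by rewrite mulr_sumr; apply: eq_bigr => b _; rewrite sym_basisE mxE mulrA mulrC.
rewrite (sym_basis_span E) !mulmxA -[_ *m _ *m sym_basis t]mulmxA.
by rewrite sym_basis_orthonormal mulmx1.
Qed.

Lemma sym_power1 : sym_power t (1%:M : 'M[C]_2) = 1%:M.
Proof.
by rewrite /sym_power tensor_op1 mulmx1 sym_basis_orthonormal.
Qed.

Lemma sym_powerM (W W' : 'M[C]_2) :
  sym_power t (W *m W') = sym_power t W *m sym_power t W'.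
Proof.
rewrite /sym_power -(tensor_opM (fun=> W) (fun=> W')) -!mulmxA.
by rewrite tensor_op_sym_basis.
Qed.

(* [spin_mx] is the matrix [(L(lam) - lam + (s - 1/2) eta) / eta] of spin
   operators; on t spins 1/2 it is the sum over the factors k of the
   permutations P_{0k}, whose (i, j) entry is the matrix unit E_ji of factor k. *)
Definition spin_mx : 'M['M[C]_t.+1]_2 :=
  mx22 ((t%:R / 2)%:M + spin_z t) (spin_minus t)
       (spin_plus t) ((t%:R / 2)%:M - spin_z t).

Definition unit_sum (i j : 'I_2) : 'M[C]_dim :=
  \sum_(k < t) @site_op _ t chain k (delta_mx j i).

Lemma sqrtCnM (a b : nat) : sqrtC ((a * b)%N%:R : C) = sqrtC a%:R * sqrtC b%:R.
Proof. by rewrite natrM sqrtCM // nnegrE ler0n. Qed.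

Lemma sqrtCnn (a : nat) : sqrtC ((a * a)%N%:R : C) = a%:R.
Proof. by rewrite sqrtCnM -expr2 sqrtCK. Qed.

(** Both identities reduce to (p+1) 'C(t, p+1) = (t-p) 'C(t, p) once the integer factors are written
    as square roots of squares. *)
Lemma sym_norm_ladder p : (p < t)%N ->
  (t - p)%:R * sym_norm p.+1 = sym_norm p * sqrtC ((p.+1 * (t - p))%N%:R) /\
  p.+1%:R * sym_norm p = sym_norm p.+1 * sqrtC ((p.+1 * (t - p))%N%:R).
Proof.
move=> pt; have k0 q : (q <= t)%N -> sqrtC ('C(t, q)%:R : C) != 0.
  by move=> /sym_norm_neq0; rewrite invr_eq0.
have bin := mul_bin_left t p.
rewrite /sym_norm ![_^-1 * _]mulrC; split; apply/eqP; rewrite eqr_div ?k0 // 1?ltnW //.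
  rewrite -(sqrtCnn (t - p)) -!sqrtCnM -mulnA -bin; apply/eqP; congr (sqrtC _%:R).
  by rewrite mulnA; congr (_ * _)%N; rewrite mulnC.
rewrite -(sqrtCnn p.+1) -!sqrtCnM -mulnA bin mulnA.
by apply/eqP; congr (sqrtC _%:R).
Qed.

(** The form in which [unit_sum] acts: a tensor of content p has t - p factors in state 0 and p in
    state 1, and replacing one factor j by i changes the content to m = p + i - j. *)
Lemma spin_mxE (i j : 'I_2) (p m : 'I_t.+1) :
  sym_norm p * spin_mx i j p m = (if j == 0 then (t - p)%N else p : nat)%:R *
     ((p + i == m + j)%N%:R * sym_norm m).
Proof.
have pt : (p <= t)%N by rewrite -ltnS.
have mt : (m <= t)%N by rewrite -ltnS.
rewrite [spin_mx i j]mxE; case: i => [[|[|[]]]] // ?; case: j => [[|[|[]]]] // ?.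
all: rewrite -!val_eqE /= ?addn0 ?addn1.
- rewrite !mxE -val_eqE /=; case: eqP => [<-|_]; last first.
    by rewrite !mulr0n addr0 !mul0r !mulr0.
  by rewrite !mulr1n mul1r natrB // addrA -splitr mulrC.
- rewrite !mxE /=; case: eqP => [pm|_]; last by rewrite !mul0r !mulr0.
  by rewrite mul1r pm (proj2 (sym_norm_ladder _)) // -pm.
- rewrite !mxE /= eq_sym; case: eqP => [pm|_]; last by rewrite !mul0r !mulr0.
  by rewrite mul1r -pm (proj1 (sym_norm_ladder _)) // pm.
- rewrite !mxE -val_eqE eqSS /=; case: eqP => [<-|_]; last first.
    by rewrite !mulr0n subr0 !mul0r !mulr0.
  by rewrite !mulr1n mul1r subKr mulrC.
Qed.

Lemma content_sum f : content f = (\sum_k f k)%N.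
Proof.
rewrite /content -sum1_card big_mkcond; apply: eq_bigr => k _; rewrite inE.
by case: (f k) => [[|[|[]]]].
Qed.

Lemma sum_eq_index f (j : 'I_2) :
  \sum_k (f k == j)%:R = (if j == 0 then (t - content f)%N else content f)%:R :> C.
Proof.
transitivity (#|[set k | f k == j]|%:R : C).
  rewrite -sum1_card natr_sum [RHS]big_mkcond; apply: eq_bigr => k _.
  by rewrite inE; case: eqP.
congr _%:R; case: j => [[|[|[]]]] // lt; rewrite -val_eqE /=.
by rewrite -card_content0; apply: eq_card => k; rewrite !inE; congr (_ == _).
Qed.

Lemma site_unit_sym_basis (i j : 'I_2) k a (m : 'I_t.+1) :
  (@site_op _ t chain k (delta_mx j i) *m sym_basis t) a m =
  ((enum_val a : qubits) k == j)%:R *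
  ((content (enum_val a) + i == m + j)%N%:R * sym_norm m).
Proof.
pose f : qubits := enum_val a.
(* The only column in which row a of this matrix unit is nonzero. *)
pose g : qubits := [ffun l => if l == k then i else f l].
have gk : g k = i by rewrite ffunE eqxx.
have cg : f k = j -> (content g + j = content f + i)%N.
  move=> fk; rewrite !content_sum [X in (X + j)%N](bigD1 k) // gk.
  rewrite [X in (X + i)%N](bigD1 k) // fk /= addnC addnA [RHS]addnAC.
  by congr (_ + _)%N; apply: eq_bigr => l lk; rewrite ffunE (negbTE lk).
rewrite mxE -/f; case: (eqVneq (f k) j) => [fk|fk]; last first.
  by rewrite mul0r big1 // => b _; rewrite site_opE mxE (negbTE fk) !mul0r.
rewrite (bigD1 (enum_rank g)) //= big1 ?addr0 => [|b bg].
  rewrite site_opE sym_basisE enum_rankK mxE -/f fk gk !eqxx !mul1r.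
  rewrite (_ : [forall _, _] = true) ?mul1r; last first.
    by apply/forallP => l; apply/implyP => lk; rewrite ffunE (negbTE lk).
  by congr (_%:R * _); rewrite -(eqn_add2r j) cg.
rewrite site_opE mxE -/f fk eqxx /=; case: (eqVneq _ i) => [bi|]; last first.
  by rewrite !mul0r.
case: forallP => [al|]; last by rewrite mulr0 mul0r.
case/eqP: bg; rewrite -[b]enum_valK; congr enum_rank; apply/ffunP => l.
rewrite ffunE; case: (eqVneq l k) => [->//|lk].
by have := al l; rewrite lk => /eqP <-.
Qed.

(** Fusion: the spin t/2 matrices are the restriction of a sum of spins 1/2, so their relations can
    be checked on single factors. *)
Lemma unit_sum_sym_basis i j :
  unit_sum i j *m sym_basis t = sym_basis t *m spin_mx i j.
Proof.
apply/matrixP => a m; rewrite mulmx_suml summxE.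
under eq_bigr do rewrite site_unit_sym_basis.
have lt : (content (enum_val a) < t.+1)%N by rewrite ltnS content_le.
rewrite -mulr_suml sum_eq_index mxE (bigD1 (Ordinal lt)) //= big1 ?addr0 => [|p].
  by rewrite sym_basisE eqxx mul1r spin_mxE.
by rewrite -val_eqE sym_basisE eq_sym => /negbTE ->; rewrite !mul0r.
Qed.

Lemma spin_mx_unit_sum i j :
  spin_mx i j = (sym_basis t)^T *m unit_sum i j *m sym_basis t.
Proof.
by rewrite -mulmxA unit_sum_sym_basis mulmxA sym_basis_orthonormal mul1mx.
Qed.

End SymmetricTensors.

(** * Commutators and rotations of the spin matrices *)

Section SpinMatrixRelations.
Context {R : realType}.
Variable t : nat.
Local Notation C := R[i].

(** Different factors commute, and on a single factor this is the commutator of matrix units. *)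
Lemma unit_sum_comm (i j k l : 'I_2) :
  unit_sum t i j *m unit_sum t k l - unit_sum t k l *m unit_sum t i j =
  (i == l)%:R *: unit_sum t k j - (k == j)%:R *: unit_sum t i l :> 'M[C]_ _.
Proof.
rewrite /unit_sum !scaler_sumr -sumrB mulmx_suml mulmx_sumr -sumrB.
apply: eq_bigr => p _; rewrite mulmx_sumr mulmx_suml -sumrB (bigD1 p) //=.
rewrite big1 => [|q qp]; last by rewrite site_op_comm ?subrr // eq_sym.
rewrite addr0 -!site_opM -site_opB !mul_delta_mx_cond -!site_opZ -site_opB.
by rewrite -[_ *+ (i == l)]scaler_nat -[_ *+ (k == j)]scaler_nat.
Qed.

Lemma spin_mxM (i j k l : 'I_2) :
  spin_mx t i j *m spin_mx t k l =
  (sym_basis t)^T *m (unit_sum t i j *m unit_sum t k l) *m sym_basis t :> 'M[C]_ _.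
Proof.
by rewrite [in LHS](spin_mx_unit_sum t i j) -!mulmxA -!unit_sum_sym_basis !mulmxA.
Qed.

Lemma spin_mx_comm (i j k l : 'I_2) :
  spin_mx t i j *m spin_mx t k l - spin_mx t k l *m spin_mx t i j =
  (i == l)%:R *: spin_mx t k j - (k == j)%:R *: spin_mx t i l :> 'M[C]_ _.
Proof.
rewrite !spin_mxM -mulmxBl -mulmxBr unit_sum_comm mulmxBr mulmxBl.
by rewrite -!scalemxAr -!scalemxAl -!spin_mx_unit_sum.
Qed.

Variable W : 'M[C]_2.
Hypothesis Wu : W \in unitmx.

Lemma conj_delta_mx (i j : 'I_2) :
  W *m delta_mx j i *m invmx W =
  \sum_a \sum_b (invmx W i a * W b j) *: delta_mx b a.
Proof.
apply/matrixP => p q; rewrite summxE (bigD1 q) //= [X in _ + X]big1 ?addr0.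
  rewrite summxE (bigD1 p) //= [X in _ + X]big1 ?addr0.
    rewrite !mxE !eqxx mulr1 (bigD1 i) //= [X in _ + X]big1 ?addr0.
      rewrite mxE (bigD1 j) //= [X in _ + X]big1 ?addr0.
        by rewrite mxE !eqxx mulr1 mulrC.
      by move=> c cj; rewrite mxE (negbTE cj) mulr0.
    move=> c ci; rewrite mxE big1 ?mul0r // => e _.
    by rewrite mxE (negbTE ci) andbF mulr0.
  by move=> b bp; rewrite !mxE eq_sym (negbTE bp) mulr0.
move=> a aq; rewrite summxE big1 // => b _.
by rewrite !mxE [q == a]eq_sym (negbTE aq) andbF mulr0.
Qed.

Lemma tensor_op_unit_sum (i j : 'I_2) :
  tensor_op (fun _ : 'I_t => W) *m unit_sum t i j =
  (\sum_a \sum_b (invmx W i a * W b j) *: unit_sum t a b) *m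
    tensor_op (fun _ : 'I_t => W).
Proof.
transitivity ((\sum_(k < t) @site_op _ t (fun=> 1%N) k
    (W *m delta_mx j i *m invmx W)) *m tensor_op (fun _ : 'I_t => W)).
  rewrite /unit_sum mulmx_sumr mulmx_suml; apply: eq_bigr => k _.
  by apply: (tensor_op_site (W := fun=> W)); rewrite mulmxKV.
congr (_ *m _); rewrite conj_delta_mx.
under eq_bigr => k _ do rewrite site_op_sum.
rewrite exchange_big; apply: eq_bigr => a _.
under eq_bigr => k _ do rewrite site_op_sum.
rewrite exchange_big; apply: eq_bigr => b _.
by rewrite /unit_sum scaler_sumr; apply: eq_bigr => k _; rewrite site_opZ.
Qed.

(** Equivariance: rotating the spin space by W amounts to replacing the 2 x 2 matrix S of spin
    operators by W^-1 S W. *)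
Lemma sym_power_spin_mx (i j : 'I_2) :
  sym_power t W *m spin_mx t i j =
  (\sum_a \sum_b (invmx W i a * W b j) *: spin_mx t a b) *m sym_power t W.
Proof.
pose S := \sum_a \sum_b (invmx W i a * W b j) *: @unit_sum R t a b.
transitivity ((sym_basis t)^T *m S *m sym_basis t *m sym_power t W).
  rewrite {1}/sym_power -[LHS]mulmxA -unit_sum_sym_basis -!mulmxA.
  rewrite [tensor_op _ *m (unit_sum _ _ _ *m _)]mulmxA tensor_op_unit_sum.
  by rewrite -!mulmxA -tensor_op_sym_basis /sym_power -!mulmxA.
congr (_ *m _); rewrite mulmx_sumr mulmx_suml; apply: eq_bigr => a _.
rewrite mulmx_sumr mulmx_suml; apply: eq_bigr => b _.
by rewrite -scalemxAr -scalemxAl -spin_mx_unit_sum.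
Qed.

End SpinMatrixRelations.

(** * The RTT relation *)

Section RTT.
Variables (F : numFieldType) (m : nat) (eta : F).
Implicit Types T : F -> 'M['M[F]_m]_2.

(* The exchange relation R_{12}(x - y) T_1(x) T_2(y) = T_2(y) T_1(x) R_{12}(x - y)
   for Yang's R-matrix, the sum of x - y and eta times the permutation. *)
Definition rtt T := forall x y (i j k l : 'I_2),
  (x - y) *: (T x i j *m T y k l) + eta *: (T x k j *m T y i l) =
  (x - y) *: (T y k l *m T x i j) + eta *: (T y k j *m T x i l).

Lemma mul_sum_comm (A B A' B' : 'I_2 -> 'M[F]_m) :
  (forall a b, B a *m A' b = A' b *m B a) ->
  (\sum_a A a *m B a) *m (\sum_b A' b *m B' b) =
  \sum_a \sum_b (A a *m A' b) *m (B a *m B' b).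
Proof.
move=> com; rewrite mulmx_suml; apply: eq_bigr => a _; rewrite mulmx_sumr.
by apply: eq_bigr => b _; rewrite -!mulmxA [B a *m (_ *m _)]mulmxA com !mulmxA.
Qed.

(** Since the entries of T commute with those of T', the R-matrix can be moved first past the two T
    and then past the two T'. *)
Lemma rtt_mul T T' :
  (forall x y i j k l, T x i j *m T' y k l = T' y k l *m T x i j) ->
  rtt T -> rtt T' -> rtt (fun x => T x *m T' x).
Proof.
move=> com rT rT' x y i j k l; rewrite !mxE !mul_sum_comm; try by move=> *; rewrite com.
rewrite [X in _ = _ *: X + _]exchange_big [X in _ = _ + _ *: X]exchange_big.
rewrite !scaler_sumr -!big_split.
transitivity (\sum_a \sum_b ((x - y) *: (T y k b *m T x i a) +
    eta *: (T y k a *m T x i b)) *m (T' x a j *m T' y b l)).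
  apply: eq_bigr => a _; rewrite !scaler_sumr -big_split; apply: eq_bigr => b _.
  by rewrite -rT mulmxDl -!scalemxAl.
(* Swapping a and b in the eta term turns its T part into that of the other term. *)
transitivity (\sum_a \sum_b (T y k b *m T x i a) *m
    ((x - y) *: (T' x a j *m T' y b l) + eta *: (T' x b j *m T' y a l))).
  under eq_bigr => a _ do [under eq_bigr => b _ do rewrite mulmxDl; rewrite big_split].
  under [RHS]eq_bigr => a _ do [under eq_bigr => b _ do rewrite mulmxDr; rewrite big_split].
  rewrite [LHS]big_split [RHS]big_split /= [X in _ + X = _]exchange_big /=.
  by congr (_ + _); do 2![apply: eq_bigr => ? _]; rewrite -scalemxAl -scalemxAr.
apply: eq_bigr => a _; rewrite !scaler_sumr -big_split; apply: eq_bigr => b _.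
by rewrite rT' mulmxDr -!scalemxAr.
Qed.

(** For equal index pairs the relation says that x - y + eta times the commutator vanishes. If this
    scalar is 0, exchanging x and y makes it 2 eta. *)
Lemma rtt_comm T : eta != 0 -> rtt T ->
  forall i j x y, T x i j *m T y i j = T y i j *m T x i j.
Proof.
move=> eta0 rT i j x y.
have key u v : u - v + eta != 0 -> T u i j *m T v i j = T v i j *m T u i j.
  by move=> nz; apply: (scalerI nz); rewrite scalerDl [RHS]scalerDl; apply: rT.
case: (eqVneq (x - y + eta) 0) => [xy|]; last exact: key.
have xe : y - x = eta by apply/esym/eqP; rewrite -subr_eq0 opprB addrC xy.
by rewrite [RHS]key // xe -mulr2n mulrn_eq0.
Qed.

(** The terms with S k j S i l agree on both sides. The commutator of S i j and S k l, with
    coefficient (x - y) eta^2, cancels against the terms linear in S that come from the permutation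
    part of R. *)
Lemma rtt_gl2 (S : 'I_2 -> 'I_2 -> 'M[F]_m) (c x y : F) (i j k l : 'I_2) :
  (forall i j k l, S i j *m S k l - S k l *m S i j =
     (i == l)%:R *: S k j - (k == j)%:R *: S i l) ->
  let T x i j := (x + c) *: (i == j)%:R%:M + eta *: S i j in
  (x - y) *: (T x i j *m T y k l) + eta *: (T x k j *m T y i l) =
  (x - y) *: (T y k l *m T x i j) + eta *: (T y k j *m T x i l).
Proof.
move=> com /=.
have mulT a b (i1 j1 k1 l1 : 'I_2) :
    (a *: (i1 == j1)%:R%:M + eta *: S i1 j1) *m (b *: (k1 == l1)%:R%:M + eta *: S k1 l1)
    = (a * b * ((i1 == j1)%:R * (k1 == l1)%:R))%:M + (a * (i1 == j1)%:R * eta) *: S k1 l1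
      + (b * (k1 == l1)%:R * eta) *: S i1 j1 + eta ^+ 2 *: (S i1 j1 *m S k1 l1).
  rewrite !scale_scalar_mx mulmxDl !mulmxDr -!scalar_mxM mul_scalar_mx mul_mx_scalar.
  rewrite -scalemxAl -scalemxAr !scalerA -expr2 !addrA.
  by congr (_%:M + _ + _ + _); ring.
have {}com : S i j *m S k l = S k l *m S i j +
    ((i == l)%:R *: S k j - (k == j)%:R *: S i l).
  by rewrite -com addrC subrK.
rewrite !mulT com; move: (S k l *m S i j) (S k j *m S i l) => A B.
move: (S i j) (S k l) (S i l) (S k j) => S1 S2 S3 S4.
move: (i == j)%:R (k == l)%:R (i == l)%:R (k == j)%:R => b1 b2 b3 b4.
apply/matrixP => a b; rewrite !mxE.
move: (A a b) (B a b) (S1 a b) (S2 a b) (S3 a b) (S4 a b) => A' B' z1 z2 z3 z4.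
case: (a == b); rewrite ?mulr1n ?mulr0n; ring.
Qed.

End RTT.

(** * The untwisted monodromy matrix *)

Section Chain.
Context {R : realType}.
Local Notation C := R[i].
Variables (N : nat) (d : 'I_N -> nat) (eta : C) (xi : 'I_N -> C).
Local Notation dim := (tensor_dim d).
Local Notation site := (@enum_val (tensor_index d) predT).

(** Taken over a list of sites to allow induction on the chain. *)
Definition bulk (s : seq 'I_N) (lam : C) : 'M['M[C]_dim]_2 :=
  \big[mulmx/1%:M]_(n <- s) lax d eta n (lam - xi n).

Lemma laxE n lam i j : lax d eta n lam i j =
  (lam + eta / 2 - eta * ((d n)%:R / 2)) *: (i == j)%:R%:M +
  eta *: @site_op _ N d n (spin_mx (d n) i j).
Proof.
set c := _ - _; have cE : lam + eta / 2 = c + eta * ((d n)%:R / 2) by rewrite subrK.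
transitivity (@site_op _ N d n (c *: (i == j)%:R%:M + eta *: spin_mx (d n) i j));
  last by rewrite site_opD !site_opZ site_op_scalar.
have z : (0%:M : 'M[C]_((d n).+1)) = 0 by exact: raddf0.
rewrite scale_scalar_mx mxE [spin_mx _ _ _]mxE.
have [->|->] := ord2_eq i; have [->|->] := ord2_eq j; congr site_op.
- by rewrite mulr1 cE scalerDr addrA raddfD /= scale_scalar_mx.
- by rewrite mulr0 z add0r.
- by rewrite mulr0 z add0r.
- by rewrite mulr1 cE scalerBr addrA raddfD /= scale_scalar_mx.
Qed.

Lemma rtt_lax n : rtt eta (lax d eta n).
Proof.
move=> x y i j k l; rewrite !laxE -!(addrA _ (eta / 2)).
apply: (@rtt_gl2 _ _ eta (fun i j => site_op (spin_mx (d n) i j))) => {}i {}j {}k {}l.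
rewrite -!site_opZ -!site_opB -!site_opM -site_opB; congr site_op.
exact: spin_mx_comm.
Qed.

Lemma lax_comm n m x y i j k l : n != m ->
  lax d eta n x i j *m lax d eta m y k l = lax d eta m y k l *m lax d eta n x i j.
Proof.
move=> nm; rewrite !mxE.
by do ![case: ifP => _]; rewrite site_op_comm.
Qed.

Lemma rtt_bulk s : uniq s -> rtt eta (bulk s).
Proof.
elim: s => [_|n s IHs /= /andP [ns us]].
  move=> x y i j k l; rewrite /bulk !big_nil !mxE.
  by rewrite -!raddfMn /= -!scalar_mxM mulrC [X in _ + _ *: X%:M]mulrC.
have -> : bulk (n :: s) = fun x => lax d eta n (x - xi n) *m bulk s x.
  by apply/funext => x; rewrite /bulk big_cons.
apply: rtt_mul; last exact: IHs.
  rewrite /bulk => x y {us IHs} i' j' k' l'.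
  elim: s ns k' l' => [|m s IHs].
    move=> _ k' l'; rewrite !big_nil [(1%:M) _ _]mxE.
    by case: (_ == _); rewrite ?mulmx0 ?mul0mx ?mulmx1 ?mul1mx.
  rewrite inE negb_or => /andP [nm ns] k' l'.
  rewrite !big_cons ![(_ *m _) k' l']mxE mulmx_suml mulmx_sumr; apply: eq_bigr => a _.
  by rewrite mulmxA lax_comm // -!mulmxA IHs.
move=> x y i j k l.
by have := rtt_lax n (x - xi n) (y - xi n) i j k l; rewrite opprB addrA subrK.
Qed.

End Chain.

(** * Rotation of the auxiliary space *)

(** The inner pairs Q P cancel between neighbouring factors. *)
Lemma conj_prod_mx (S : pzRingType) m (G P Q : 'M[S]_m) I (L : I -> 'M[S]_m) r :
  P *m Q = 1%:M -> Q *m P = 1%:M -> (forall i, G *m L i = P *m L i *m Q *m G) ->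
  G *m (\big[mulmx/1%:M]_(i <- r) L i) =
  P *m (\big[mulmx/1%:M]_(i <- r) L i) *m Q *m G.
Proof.
move=> PQ QP conjL; elim: r => [|i r IHr].
  by rewrite big_nil !mulmx1 PQ mul1mx.
rewrite big_cons mulmxA conjL -mulmxA IHr !mulmxA.
by rewrite -[_ *m Q *m P]mulmxA QP mulmx1.
Qed.

Section Rotation.
Context {R : realType}.
Local Notation C := R[i].
Variables (N : nat) (d : 'I_N -> nat) (eta : C) (xi : 'I_N -> C).
Local Notation dim := (tensor_dim d).

Lemma induced_op1 : induced_op d (1%:M : 'M[C]_2) = 1%:M.
Proof. by rewrite -tensor_op1; apply: eq_tensor_op => n; rewrite sym_power1. Qed.

Lemma induced_opM (V W : 'M[C]_2) :
  induced_op d (V *m W) = induced_op d V *m induced_op d W.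
Proof.
by rewrite /induced_op tensor_opM; apply: eq_tensor_op => n; rewrite sym_powerM.
Qed.

Lemma induced_op_unit (W : 'M[C]_2) : W \in unitmx -> induced_op d W \in unitmx.
Proof.
move=> Wu; have : induced_op d W *m induced_op d (invmx W) = 1%:M.
  by rewrite -induced_opM mulmxV // induced_op1.
by move=> /mulmx1_unit [Uu _]; exact: Uu.
Qed.

Lemma auxM (V W : 'M[C]_2) : aux dim (V *m W) = aux dim V *m aux dim W.
Proof. exact: map_mxM. Qed.

Lemma aux1 : aux dim (1%:M : 'M[C]_2) = 1%:M.
Proof. by rewrite /aux map_scalar_mx. Qed.

Lemma aux_conjE (V W : 'M[C]_2) (M : 'M['M[C]_dim]_2) i j :
  (aux dim V *m M *m aux dim W) i j = \sum_a \sum_b (V i a * W b j) *: M a b.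
Proof.
rewrite mxE exchange_big; apply: eq_bigr => b _.
rewrite [aux _ W b j]mxE -mulmxE mul_mx_scalar mxE scaler_sumr.
by apply: eq_bigr => a _; rewrite mxE -mulmxE mul_scalar_mx scalerA mulrC.
Qed.

Lemma aux_mulE (V : 'M[C]_2) (M : 'M['M[C]_dim]_2) i j :
  (aux dim V *m M) i j = \sum_a V i a *: M a j.
Proof.
by rewrite mxE; apply: eq_bigr => a _; rewrite mxE -mulmxE mul_scalar_mx.
Qed.

Lemma mulmx_scalarE (M : 'M['M[C]_dim]_2) (A : 'M[C]_dim) i j :
  (M *m A%:M) i j = M i j *m A.
Proof.
rewrite mxE (bigD1 j) //= big1 => [|k kj]; first by rewrite addr0 mxE eqxx.
by rewrite mxE (negbTE kj) mulr0.
Qed.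

Variable W : 'M[C]_2.
Hypothesis Wu : W \in unitmx.

Lemma lax_rotation n lam :
  (induced_op d W)%:M *m lax d eta n lam =
  aux dim (invmx W) *m lax d eta n lam *m aux dim W *m (induced_op d W)%:M.
Proof.
apply/matrixP => i j; rewrite mul_scalar_mx [LHS]mxE -mulmxE laxE mulmxDr -!scalemxAr.
rewrite (tensor_op_site (sym_power_spin_mx _ Wu i j)).
rewrite scalar_mxC !scalemxAl -mulmxDl mulmx_scalarE aux_conjE.
congr (_ *m _); rewrite site_op_sum scaler_sumr.
(* The scalar part of the Lax matrix is invariant because W^-1 W = 1. *)
have -> : (i == j)%:R = \sum_a \sum_b invmx W i a * W b j * (a == b)%:R :> C.
  have := congr1 (fun A : 'M_2 => A i j) (mulVmx Wu); rewrite !mxE => <-.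
  apply: eq_bigr => a _; rewrite (bigD1 a) //= big1 ?eqxx ?addr0 ?mulr1 // => b ba.
  by rewrite eq_sym (negbTE ba) mulr0.
rewrite raddf_sum /= scaler_sumr -big_split; apply: eq_bigr => a _.
rewrite site_op_sum raddf_sum /= !scaler_sumr -big_split; apply: eq_bigr => b _.
by rewrite laxE site_opZ scalerDr !scale_scalar_mx !scalerA; congr (_%:M + _ *: _); ring.
Qed.

Lemma bulk_rotation s lam :
  (induced_op d W)%:M *m bulk d eta xi s lam =
  aux dim (invmx W) *m bulk d eta xi s lam *m aux dim W *m (induced_op d W)%:M.
Proof.
apply: conj_prod_mx; [by rewrite -auxM mulVmx ?aux1 | by rewrite -auxM mulmxV ?aux1 |].
by move=> n; exact: lax_rotation.
Qed.

Lemma bulk_rotationE s lam i j :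
  induced_op d W *m bulk d eta xi s lam i j =
  (aux dim (invmx W) *m bulk d eta xi s lam *m aux dim W) i j *m induced_op d W.
Proof.
by rewrite -mulmx_scalarE -bulk_rotation mul_scalar_mx mxE.
Qed.

End Rotation.

(** * Spectrum of D *)

Section GradedTriangular.
Variables (F : fieldType) (m : nat) (h : 'I_m -> nat).

(** Ties in h are allowed, but entries between distinct indices of equal grade must vanish; this
    avoids choosing a total order. *)
Definition graded_triangular (A : 'M[F]_m) :=
  forall i j, A i j != 0 -> i = j \/ (h i < h j)%N.

(** A permutation with a nonzero term can only raise h at each index. It preserves the sum of h,
    hence h itself, and so fixes every index. *)
Lemma det_graded_triangular A : graded_triangular A -> \det A = \prod_i A i i.
Proof.
move=> tA; rewrite /determinant (bigD1 (1%g : {perm 'I_m})) //= [X in _ + X]big1 ?addr0.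
  by rewrite odd_perm1 mul1r; apply: eq_bigr => i _; rewrite perm1.
move=> s s1; case: (eqVneq (\prod_i A i (s i)) 0) => [->|nz]; first by rewrite mulr0.
have tri i : i = s i \/ (h i < h (s i))%N.
  by apply: tA; apply: contraNneq nz => Ai; rewrite (bigD1 i) //= Ai mul0r.
case/eqP: s1; apply/permP => i; rewrite perm1.
have : (\sum_j h j = \sum_j h (s j))%N by rewrite (reindex_inj (@perm_inj _ s)).
have le j : (h j <= h (s j) ?= iff (h j == h (s j)))%N.
  split=> //; by case: (tri j) => [{1}->|/ltnW].
move=> /eqP; rewrite (leqif_sum (fun j _ => le j)) => /forallP /(_ i) /= /eqP hi.
by case: (tri i) => [<-//|]; rewrite -hi ltnn.
Qed.

(** At an index i of maximal grade in the support of v, the eigenvalue equation reduces to A i i = A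
    g g, which forces i = g. *)
Lemma graded_triangular_eigenvector A g (v : 'cV[F]_m) :
  graded_triangular A -> (forall i, A i i = A g g -> i = g) ->
  A *m v = A g g *: v -> v != 0 ->
  v g 0 != 0 /\ forall i, v i 0 != 0 -> i = g \/ (h i < h g)%N.
Proof.
move=> tA inj eigv v0.
have top i : v i 0 != 0 -> (forall j, v j 0 != 0 -> (h j <= h i)%N) -> i = g.
  move=> vi mx; apply: inj; apply: (mulIf vi).
  have := congr1 (fun w : 'cV_m => w i 0) eigv; rewrite !mxE => <-.
  rewrite (bigD1 i) //= [X in _ + X]big1 ?addr0 // => j ji.
  case: (eqVneq (v j 0) 0) => [->|vj]; first by rewrite mulr0.
  case: (eqVneq (A i j) 0) => [->|Aij]; first by rewrite mul0r.
  have := mx j vj; case: (tA i j Aij) => [ij|]; first by rewrite ij eqxx in ji.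
  by rewrite ltnNge => /negbTE ->.
have [i0 vi0] : exists i, v i 0 != 0.
  apply/existsP; apply: contraNT v0; rewrite negb_exists => /forallP v0.
  by apply/eqP/matrixP => i j; rewrite ord1 mxE; apply/eqP; rewrite -[_ == _]negbK.
case: (@arg_maxnP _ i0 (fun i => v i 0 != 0) h vi0) => i vi mx.
have ig : i = g by apply: top.
split=> [|j vj]; first by rewrite -ig.
case: (ltnP (h j) (h g)) => hj; [by right | left].
by apply: top => // k vk; rewrite (leq_trans _ hj) // -ig; apply: mx.
Qed.

(* Triangularity alone does not make the family diagonal, but one member with
   distinct diagonal entries has one-dimensional eigenspaces, which all the
   others preserve; the eigenvectors are again unitriangular, so that the
   eigenvalues are the diagonal entries. *)
Lemma graded_triangular_eigenbasis (T : Type) (X : T -> 'M[F]_m) t0 :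
  (forall t, graded_triangular (X t)) ->
  (forall s t, X s *m X t = X t *m X s) ->
  (forall i j, X t0 i i = X t0 j j -> i = j) ->
  exists2 P : 'M[F]_m, P \in unitmx &
    forall t j, X t *m col j P = X t j j *: col j P.
Proof.
move=> tX comX inj; pose A := X t0.
have ker g (v : 'cV[F]_m) : A *m v = A g g *: v -> v g 0 = 0 -> v = 0.
  move=> eigv vg; apply/eqP; apply: contraTT isT => v0.
  have [] := graded_triangular_eigenvector (tX t0) (fun i => inj i g) eigv v0.
  by rewrite vg eqxx.
have ex g : exists v : 'cV[F]_m, [/\ A *m v = A g g *: v, v g 0 = 1
    & forall i, v i 0 != 0 -> i = g \/ (h i < h g)%N].
  (* [det0P] gives a row vector in the kernel, hence the transpose. *)
  have /eqP/det0P [w w0 wA] : \det (A - (A g g)%:M)^T = 0.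
    rewrite det_tr det_graded_triangular; last first.
      move=> i j; rewrite !mxE; case: (eqVneq i j) => [|ij]; first by left.
      by rewrite mulr0n subr0 => /tX.
    by rewrite (bigD1 g) //= !mxE eqxx subrr mul0r.
  pose v := w^T.
  have v0 : v != 0 by rewrite -(inj_eq trmx_inj) trmxK trmx0.
  have eigv : A *m v = A g g *: v.
    apply/eqP; rewrite -subr_eq0 -mul_scalar_mx -mulmxBl.
    by rewrite -[_ - _]trmxK -trmx_mul wA trmx0.
  have [vg supp] := graded_triangular_eigenvector (tX t0) (fun i => inj i g) eigv v0.
  exists ((v g 0)^-1 *: v); split; first by rewrite -scalemxAr eigv !scalerA mulrC.
    by rewrite mxE mulVf.
  by move=> i; rewrite mxE mulf_eq0 negb_or => /andP [_ /supp].
have [f fP] := fin_all_exists ex.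
pose P := \matrix_(i, g) f g i 0.
have colP g : col g P = f g by apply/matrixP => i j; rewrite !mxE ord1.
exists P => [|t g].
  rewrite unitmxE det_graded_triangular => [|i j].
    by rewrite big1 ?unitr1 // => i _; rewrite mxE; case: (fP i).
  by rewrite mxE => nz; case: (fP j) => _ _ /(_ i nz).
rewrite colP; case: (fP g) => eigf fg supp.
(* Off g, the support of f g has grade below h g, while row g of X t only reaches grades above
   it. *)
have diag : (X t *m f g) g 0 = X t g g.
  rewrite mxE (bigD1 g) //= fg mulr1 big1 ?addr0 // => i ig.
  case: (eqVneq (f g i 0) 0) => [->|fi]; first by rewrite mulr0.
  case: (eqVneq (X t g i) 0) => [->|xi]; first by rewrite mul0r.
  case: (supp i fi) (tX t g i xi) => [ig'|hi] [gi|hi'].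
  - by rewrite ig' eqxx in ig.
  - by rewrite ig' eqxx in ig.
  - by rewrite gi eqxx in ig.
  - by have := ltn_trans hi hi'; rewrite ltnn.
(* The difference satisfies the same eigenvalue equation for A, and its coordinate g is 0. *)
apply/eqP; rewrite -subr_eq0; apply/eqP; apply: (ker g).
  rewrite mulmxBr mulmxA (comX t0 t) -mulmxA eigf -!scalemxAr eigf scalerBr.
  by rewrite !scalerA mulrC.
by rewrite mxE diag mxE mxE fg mulr1 subrr.
Qed.

End GradedTriangular.

(** * Triangularity of D in the canonical basis *)

Section Triangularity.
Context {R : realType}.
Local Notation C := R[i].
Variables (N : nat) (d : 'I_N -> nat) (eta : C) (xi : 'I_N -> C).
Local Notation dim := (tensor_dim d).
Local Notation site a := (enum_val a : tensor_index d).

(** Linear in the position, so that S^+ at n combined with S^- at m changes it by m - n from column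
    to row. *)
Definition weight (a : 'I_dim) : nat := (\sum_(n < N) n * site a n)%N.

Lemma site_op_neq0 n (A : 'M[C]_((d n).+1)) (a b : 'I_dim) :
  site_op A a b != 0 -> A (site a n) (site b n) != 0 /\
    forall m, m != n -> site a m = site b m.
Proof.
rewrite site_opE mulf_eq0 negb_or => /andP [-> ].
case: forallP => [al _|]; last by rewrite eqxx.
by split=> // m mn; have := al m; rewrite mn => /eqP.
Qed.

Lemma site_op_weight n (A : 'M[C]_((d n).+1)) (a b : 'I_dim) :
  site_op A a b != 0 -> (weight a + n * site b n = weight b + n * site a n)%N.
Proof.
move=> /site_op_neq0 [_ ab]; rewrite /weight (bigD1 n) //=.
rewrite [X in (_ = X + _)%N](bigD1 n) //= addnAC [RHS]addnAC [X in (X + _)%N = _]addnC.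
by congr (_ + _)%N; apply: eq_bigr => m mn; rewrite ab.
Qed.

Lemma site_op_diag n (A : 'M[C]_((d n).+1)) (a b : 'I_dim) :
  (forall i j, i != j -> A i j = 0) -> site_op A a b != 0 -> a = b.
Proof.
move=> dA /site_op_neq0 [nz ab]; apply: enum_val_inj; apply/ffunP => m.
have [E|mn] := eqVneq m n; last exact: ab.
by rewrite E; apply/eqP; apply: contraNT nz => /dA ->.
Qed.

Lemma lax00_diag n lam a b : lax d eta n lam 0 0 a b != 0 -> a = b.
Proof.
rewrite mxE => /site_op_diag; apply => i j ij.
by rewrite !mxE (negbTE ij) !mulr0n mulr0 addr0.
Qed.

Lemma lax11_diag n lam a b : lax d eta n lam 1 1 a b != 0 -> a = b.
Proof.
rewrite mxE => /site_op_diag; apply => i j ij.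
by rewrite !mxE (negbTE ij) !mulr0n mulr0 subr0.
Qed.

Lemma lax10_weight n lam a b :
  lax d eta n lam 1 0 a b != 0 -> weight b = (weight a + n)%N.
Proof.
rewrite mxE /= => nz; have := site_op_weight nz; have [] := site_op_neq0 nz.
rewrite !mxE; case: ifP => [/eqP -> _ _|]; last by rewrite mulr0 eqxx.
by rewrite mulnS addnA => /addIn ->.
Qed.

Lemma lax01_weight n lam a b :
  lax d eta n lam 0 1 a b != 0 -> weight a = (weight b + n)%N.
Proof.
rewrite mxE /= => nz; have := site_op_weight nz; have [] := site_op_neq0 nz.
rewrite !mxE; case: ifP => [/eqP -> _ _|]; last by rewrite mulr0 eqxx.
by rewrite mulnS addnA => /addIn ->.
Qed.

Lemma lax11E n lam a : lax d eta n lam 1 1 a a =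
  lam + eta / 2 - eta * ((d n)%:R / 2 - (site a n)%:R).
Proof.
rewrite mxE site_opE (_ : [forall _, _] = true); last first.
  by apply/forallP => m; rewrite eqxx implybT.
by rewrite !mxE eqxx mulr1.
Qed.

Lemma mulmx_neq0 (A B : 'M[C]_dim) a b : (A *m B) a b != 0 ->
  exists2 c, A a c != 0 & B c b != 0.
Proof.
rewrite mxE => nz; have : [exists c, (A a c != 0) && (B c b != 0)].
  apply: contraNT nz; rewrite negb_exists => /forallP z; rewrite big1 // => c _.
  have := z c; rewrite negb_and !negbK => /orP [] /eqP ->; by rewrite ?mul0r ?mulr0.
by case/existsP => c /andP [? ?]; exists c.
Qed.

(* In a product over decreasing sites, D only has terms where each S^+ at a site
   is followed by S^- at a smaller site: off the diagonal the weight strictly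
   decreases from column to row index. *)
Lemma bulk_triangular s lam : path.sorted (fun n m : 'I_N => (m < n)%N) s ->
  [/\ graded_triangular weight (bulk d eta xi s lam 1 1),
      (forall a b, bulk d eta xi s lam 0 1 a b != 0 ->
         forall n : nat, all (fun m : 'I_N => (m < n)%N) s ->
         (weight a < weight b + n)%N)
    & forall a, bulk d eta xi s lam 1 1 a a =
        \prod_(n <- s) lax d eta n (lam - xi n) 1 1 a a].
Proof.
elim: s => [_|n s IHs srt].
  rewrite /bulk big_nil; split=> [a b|a b|a].
  - by rewrite mxE mxE; case: (eqVneq a b) => [|_ /eqP //]; left.
  - have -> : (1%:M : 'M['M[C]_dim]_2) 0 1 = 0 by rewrite mxE.
    by rewrite mxE eqxx.
  - by rewrite !mxE eqxx big_nil.
have tr : transitive (fun n m : 'I_N => (m < n)%N).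
  by move=> x y z xy zx; apply: ltn_trans zx xy.
have below : all (fun m : 'I_N => (m < n)%N) s by have /= := order_path_min tr srt.
have {IHs} [tri low diag] := IHs (path_sorted srt).
have step i : bulk d eta xi (n :: s) lam i 1 =
    lax d eta n (lam - xi n) i 0 *m bulk d eta xi s lam 0 1 +
    lax d eta n (lam - xi n) i 1 *m bulk d eta xi s lam 1 1.
  rewrite /bulk big_cons [LHS]mxE big_ord_recl big_ord1.
  by have -> : lift ord0 ord0 = 1 :> 'I_2 by apply: val_inj.
have split_add (A B : 'M[C]_dim) a b : (A + B) a b != 0 -> A a b != 0 \/ B a b != 0.
  rewrite mxE; case: (eqVneq (A a b) 0) => [->|]; last by left.
  by rewrite add0r; right.
(* S^+ at n lowers the weight by n, and the entry B of the lower sites raises it by less than n. *)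
have raise a b : (lax d eta n (lam - xi n) 1 0 *m bulk d eta xi s lam 0 1) a b != 0 ->
    (weight a < weight b)%N.
  move=> /mulmx_neq0 [c /lax10_weight wc /low /(_ n below)].
  by rewrite wc ltn_add2r.
split=> [a b|a b|a].
- rewrite step => /split_add [/raise|]; first by right.
  by move=> /mulmx_neq0 [c /lax11_diag -> /tri].
(* Either B of the lower sites acts, and the bound holds by induction, or S^- at n raises the weight
   by n and D of the lower sites does not increase it. *)
- rewrite step => /split_add [] /mulmx_neq0 [c].
    move=> /lax00_diag <- /low /(_ n below) lt m /= /andP [nm _].
    by apply: leq_trans lt _; rewrite leq_add2l ltnW.
  move=> /lax01_weight -> tr' m /= /andP [nm _].
  rewrite (@leq_ltn_trans (weight b + n)) ?ltn_add2l // leq_add2r.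
  by case: (tri _ _ tr') => [-> //|/ltnW].
rewrite step mxE big_cons.
have -> : (lax d eta n (lam - xi n) 1 0 *m bulk d eta xi s lam 0 1) a a = 0.
  by apply/eqP; apply: contraTT isT => /raise; rewrite ltnn.
rewrite add0r -diag mxE (bigD1 a) //= big1 ?addr0 // => c ca.
case: (eqVneq (lax d eta n (lam - xi n) 1 1 a c) 0) => [->|/lax11_diag ac].
  by rewrite mul0r.
by rewrite ac eqxx in ca.
Qed.

End Triangularity.

(** * Separate variables from an eigenbasis *)

Section EigenbasisAlgebra.
Context {R : realType}.
Local Notation C := R[i].
Variables (m : nat) (P : 'M[C]_m).
Hypothesis Pu : P \in unitmx.

Lemma eq_on_basis (A B : 'M[C]_m) :
  (forall j, A *m col j P = B *m col j P) -> A = B.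
Proof.
move=> AB; apply: (can_inj (mulmxK Pu)); apply/matrixP => i j.
have := congr1 (fun v : 'cV_m => v i 0) (AB j).
by rewrite !colE !mulmxA -!colE !mxE.
Qed.

(** Y n is P diag(y) P^-1; commutation and factorization then hold on each basis vector. *)
Lemma sov_of_eigenbasis N (X : C -> 'M[C]_m) (x : C) (y : 'I_m -> 'I_N -> C) :
  x != 0 ->
  (forall t j, X t *m col j P = (x * \prod_n (t - y j n)) *: col j P) ->
  (forall i j, (forall t, \prod_n (t - y i n) = \prod_n (t - y j n)) -> i = j) ->
  sklyanin_sov N X.
Proof.
move=> x0 eigX simple; split.
  exists P, (fun j t => x * \prod_n (t - y j n)); split=> [|i j E]; first by split.
  by apply: simple => t; apply: (mulfI x0); apply: E.
have [Y eigY] : exists Y : 'I_N -> 'M[C]_m,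
    forall n j, Y n *m col j P = y j n *: col j P.
  exists (fun n => P *m diag_mx (\row_j y j n) *m invmx P) => n j.
  rewrite colE mulmxA mulmxKV // -mulmxA scalemxAr; congr (_ *m _).
  apply/matrixP => k l; rewrite ord1 mul_diag_mx !mxE.
  by case: eqP => [->//|_]; rewrite !mulr0.
have comY n k : Y n *m Y k = Y k *m Y n.
  by apply: eq_on_basis => j; rewrite -!mulmxA !eigY -!scalemxAr !eigY !scalerA mulrC.
exists Y, x, P, y; split=> [||//|lam]; [exact: x0 | exact: comY |].
apply: eq_on_basis => j; rewrite eigX -scalemxAl -scalerA; congr (_ *: _).
elim/big_rec2: _ => [|n p M _ IH]; first by rewrite mul1mx scale1r.
by rewrite -mulmxA -IH -scalemxAr mulmxBl mul_scalar_mx eigY -scalerBl scalerA mulrC.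
Qed.

End EigenbasisAlgebra.

(** In characteristic 0 the first [size p] naturals are distinct, too many to be all roots. *)
Lemma exists_nonroot (F : numFieldType) (p : {poly F}) :
  p != 0 -> exists x, p.[x] != 0.
Proof.
move=> p0; pose s : seq F := [seq i%:R | i <- iota 0 (size p)].
have us : uniq s.
  by rewrite map_inj_uniq ?iota_uniq // => i j /eqP; rewrite eqr_nat => /eqP.
have [/allP al|/allPn [x _ px]] := boolP (all (root p) s); last by exists x.
have := max_poly_roots p0 (introT allP al) us.
by rewrite size_map size_iota ltnn.
Qed.

Definition sites (N : nat) : seq 'I_N := [seq rev_ord n | n <- index_enum 'I_N].

Lemma sites_sorted N : path.sorted (fun n m : 'I_N => (m < n)%N) (sites N).
Proof.
rewrite sorted_map; apply: (@sub_sorted _ (relpre val ltn)).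
  move=> n m /= nm; apply: ltn_sub2l => //.
  exact: leq_ltn_trans nm (ltn_ord m).
by rewrite [index_enum _]unlock -enumT -sorted_map val_enum_ord iota_ltn_sorted.
Qed.

Lemma sites_uniq N : uniq (sites N).
Proof. by rewrite map_inj_uniq ?index_enum_uniq //; apply: rev_ord_inj. Qed.

(** * Disjoint ladders and the eigenbasis of D *)

Section SpectrumOfD.
Context {R : realType}.
Local Notation C := R[i].
Variables (N : nat) (d : 'I_N -> nat) (eta : C) (xi : 'I_N -> C).
Local Notation dim := (tensor_dim d).
Local Notation site a := (enum_val a : tensor_index d).

Lemma monodromy_bulk K lam :
  monodromy d eta xi K lam = aux dim K *m bulk d eta xi (sites N) lam.
Proof. by rewrite /monodromy /bulk big_map. Qed.

(* The zeros of the eigenvalues of D attached to site n. *)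
Definition ladder n (k : nat) : C := xi n - eta / 2 + eta * ((d n)%:R / 2 - k%:R).

Definition zeros (a : 'I_dim) n : C := ladder n (site a n).

Lemma bulk11_diag lam a :
  bulk d eta xi (sites N) lam 1 1 a a = \prod_n (lam - zeros a n).
Proof.
have [_ _ ->] := @bulk_triangular R N d eta xi (sites N) lam (sites_sorted N).
rewrite big_map [RHS](reindex_inj rev_ord_inj) /=; apply: eq_bigr => n _.
by rewrite lax11E /zeros /ladder; ring.
Qed.

Hypothesis eta0 : eta != 0.
Hypothesis generic : forall i j, i != j -> neq_mod eta (xi i) (xi j).
Hypothesis generic_mixed : mixed_spins_generic d eta xi.

Lemma ladder_inj n m j k : ladder n j = ladder m k -> n = m /\ j = k.
Proof.
have [<-|nm] := eqVneq n m.
  move=> /addrI /(mulfI eta0) /addrI /oppr_inj /eqP.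
  by rewrite eqr_nat => /eqP.
move=> E; exfalso.
have dnm := odd_double_half (d n + d m).
have {}dnm : (d n)%:R + (d m)%:R =
    (odd (d n + d m))%:R + 2 * ((d n + d m)./2)%:R :> C.
  by rewrite -natrM -!natrD mul2n dnm.
have dm : (d m)%:R = (odd (d n + d m))%:R + 2 * ((d n + d m)./2)%:R - (d n)%:R :> C.
  by rewrite -dnm addrC addKr.
(* Equality of the zeros gives xi_n - xi_m = eta (s_m - s_n - k + j). Here s_m - s_n is (d n + d m)
   / 2 - d n, so q is the integer part and the parity of d n + d m contributes a possible 1/2. *)
pose q : int := ((d n + d m)./2)%:Z - (d n)%:Z - k%:Z + j%:Z.
have qE : q%:~R = ((d n + d m)./2)%:R - (d n)%:R - k%:R + j%:R :> C.
  by rewrite /q !rmorphD /= !rmorphN.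
have xiE : xi n - xi m = (q%:~R + (odd (d n + d m))%:R / 2) * eta.
  have -> : xi n = ladder m k + eta / 2 - eta * ((d n)%:R / 2 - j%:R).
    by rewrite -E /ladder; ring.
  by rewrite qE /ladder dm; field.
case: (boolP (odd (d n + d m))) xiE => [/generic_mixed/(_ q)/eqP ne|_] xiE.
  by case: ne; rewrite opprD addrA xiE mul1r; ring.
have /eqP := generic nm q; apply.
by rewrite xiE mul0r addr0.
Qed.

(** At t = [zeros a n] some factor for b vanishes; by disjointness of the ladders it belongs to site
    n and has the same index. *)
Lemma zeros_simple a b :
  (forall t, \prod_n (t - zeros a n) = \prod_n (t - zeros b n)) -> a = b.
Proof.
move=> E; apply: enum_val_inj; apply/ffunP => n.
have := E (zeros a n); rewrite (bigD1 n) //= subrr mul0r.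
move=> /esym /eqP /prodf_eq0 [m _]; rewrite subr_eq0 => /eqP /ladder_inj [nm].
by case: m / nm => /val_inj.
Qed.

(** Any point outside the zeros of the product of all differences of eigenvalue polynomials will
    do. *)
Lemma exists_separating_point :
  exists t, forall a b, \prod_n (t - zeros a n) = \prod_n (t - zeros b n) -> a = b.
Proof.
pose p a : {poly C} := \prod_n ('X - (zeros a n)%:P).
have pE a t : (p a).[t] = \prod_n (t - zeros a n).
  by rewrite horner_prod; apply: eq_bigr => n _; rewrite hornerXsubC.
have [|t] := @exists_nonroot _
    (\prod_(ab : 'I_dim * 'I_dim | ab.1 != ab.2) (p ab.1 - p ab.2)).
  apply/prodf_neq0 => -[a b] /= ab; rewrite subr_eq0; apply: contraNneq ab => pab.
  by apply/eqP/zeros_simple => t; rewrite -!pE pab.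
rewrite horner_prod => /prodf_neq0 nz; exists t => a b E.
apply/eqP; apply: contraTT isT => ab.
by have := nz (a, b) ab; rewrite hornerD hornerN !pE E subrr eqxx.
Qed.

Lemma bulk11_eigenbasis : exists2 P : 'M[C]_dim, P \in unitmx &
  forall t j, bulk d eta xi (sites N) t 1 1 *m col j P =
    (\prod_n (t - zeros j n)) *: col j P.
Proof.
have [t0 sep] := exists_separating_point.
have := @graded_triangular_eigenbasis _ _ (@weight N d) C
  (fun t => bulk d eta xi (sites N) t 1 1) t0.
case=> [t|s t|a b|P Pu eigP].
- by have [] := @bulk_triangular R N d eta xi (sites N) t (sites_sorted N).
- apply: (@rtt_comm _ _ eta (bulk d eta xi (sites N)) eta0).
  exact/rtt_bulk/sites_uniq.
- by rewrite !bulk11_diag; apply: sep.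
by exists P => // t j; rewrite eigP bulk11_diag.
Qed.

End SpectrumOfD.

(** * Separation of variables *)

Lemma invmx_left (F : fieldType) m (V W : 'M[F]_m) :
  V *m W = 1%:M -> W \in unitmx /\ invmx W = V.
Proof.
move=> VW; have [_ Wu] := mulmx1_unit VW.
by split=> //; rewrite -[invmx W]mul1mx -VW -mulmxA mulmxV // mulmx1.
Qed.

Lemma mulmx_ord2E (S : pzSemiRingType) m n (A : 'M[S]_(m, 2)) (B : 'M[S]_(2, n)) i j :
  (A *m B) i j = A i 0 * B 0 j + A i 1 * B 1 j.
Proof.
rewrite mxE big_ord_recl big_ord1.
by have -> : lift ord0 ord0 = 1 :> 'I_2 by apply: val_inj.
Qed.

Lemma mul_delta_mxE (S : comNzRingType) m n p q (A : 'M[S]_(m, n)) (B : 'M[S]_(p, q))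
    j i b a : (A *m delta_mx j i *m B) b a = A b j * B i a.
Proof.
by rewrite -(mul_delta_mx (0 : 'I_1)) mulmxA -mulmxA -colE -rowE mxE big_ord1 !mxE.
Qed.

Lemma eq_mx22 (T : Type) (A B : 'M[T]_2) :
  A 0 0 = B 0 0 -> A 0 1 = B 0 1 -> A 1 0 = B 1 0 -> A 1 1 = B 1 1 -> A = B.
Proof.
move=> *; apply/matrixP => i j.
by have [->|->] := ord2_eq i; have [->|->] := ord2_eq j.
Qed.

(* With [W := mx22 1 1 r s], the two off-diagonal entries of W^-1 K W are, up to
   a factor -1 for the second, the values at s and at r of the polynomial
   K_01 X^2 + (K_00 - K_11) X - K_10, divided by s - r. *)
Lemma exists_admissible_rotation (R : realType) (K : 'M[R[i]]_2) :
  ~~ is_scalar_mx K -> exists W, admissible_rotation K W.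
Proof.
move=> nsc; pose p : {poly R[i]} :=
  K 0 1 *: 'X^2 + (K 0 0 - K 1 1) *: 'X - (K 1 0)%:P.
have pE x : p.[x] = K 0 1 * x ^+ 2 + (K 0 0 - K 1 1) * x - K 1 0.
  by rewrite /p !hornerE.
have p0 : p != 0.
  apply: contraNneq nsc => p0.
  have e x : K 0 1 * x ^+ 2 + (K 0 0 - K 1 1) * x - K 1 0 = 0.
    by rewrite -pE p0 horner0.
  have K10 : K 1 0 = 0.
    have := e 0; rewrite expr0n /= !mulr0 addr0 sub0r => /eqP.
    by rewrite oppr_eq0 => /eqP.
  have K01 : K 0 1 = 0.
    (* The even part of p at 1 is K_01 - K_10. *)
    have := congr2 (fun x y => (x + y) / 2) (e 1) (e (-1)).
    by rewrite K10 addr0 mul0r => <-; field.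
  have K00 : K 0 0 = K 1 1.
    by apply/eqP; rewrite -subr_eq0 -(e 1) K10 K01; apply/eqP; ring.
  apply/is_scalar_mxP; exists (K 0 0).
  by apply: eq_mx22; rewrite !mxE ?mulr1n ?mulr0n.
have [s ps] := exists_nonroot p0.
(* The factor X - s makes r differ from s, so that W is invertible. *)
have [|r] := @exists_nonroot _ (p * ('X - s%:P)).
  by rewrite mulf_neq0 // polyXsubC_eq0.
rewrite hornerM hornerXsubC mulf_eq0 negb_or => /andP [pr].
rewrite subr_eq0 eq_sym -subr_eq0 => rs.
pose V := (s - r)^-1 *: mx22 s (-1) (- r) 1.
have [|Wu VE] := @invmx_left _ _ V (mx22 1 1 r s).
  by apply: eq_mx22; rewrite mulmx_ord2E !mxE /=; field.
exists (mx22 1 1 r s); split=> //; rewrite VE !mulmx_ord2E !mxE /=.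
  rewrite (_ : _ + _ = (s - r)^-1 * p.[s]) ?mulf_neq0 ?invr_eq0 //.
  by rewrite pE; field.
rewrite (_ : _ + _ = (s - r)^-1 * - p.[r]) ?mulf_neq0 ?invr_eq0 ?oppr_eq0 //.
by rewrite pE; field.
Qed.

Section SeparationOfVariables.
Context {R : realType}.
Local Notation C := R[i].
Variables (N : nat) (d : 'I_N -> nat) (eta : C) (xi : 'I_N -> C).
Hypothesis eta0 : eta != 0.
Hypothesis generic : forall i j, i != j -> neq_mod eta (xi i) (xi j).
Hypothesis generic_mixed : mixed_spins_generic d eta xi.
Local Notation dim := (tensor_dim d).

(* The (i, j) entry only depends on the row u = V_i. and the column w = W_.j.
   A matrix W' with W' e_2 = w and u W' = (0, u.w) rotates it into u.w times D. *)
Lemma sov_matrix_element (V W : 'M[C]_2) i j :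
  (V *m W) i j != 0 ->
  sklyanin_sov N (fun lam =>
    (aux dim V *m bulk d eta xi (sites N) lam *m aux dim W) i j).
Proof.
set c := (V *m W) i j => c0.
have cE : c = V i 0 * W 0 j + V i 1 * W 1 j by rewrite /c mulmx_ord2E.
(* The first column is annihilated by u and the determinant is -c; the second row of the inverse is
   therefore u / c. *)
pose W' := mx22 (- V i 1) (W 0 j) (V i 0) (W 1 j).
pose V' := c^-1 *: mx22 (- W 1 j) (W 0 j) (V i 0) (V i 1).
have [|W'u V'E] := @invmx_left _ _ V' W'.
  by apply: eq_mx22; rewrite mulmx_ord2E !mxE /= cE; field; rewrite -cE.
have [P Pu eigP] := bulk11_eigenbasis eta0 generic generic_mixed.
pose U := induced_op d W'.
have Uu : U \in unitmx by apply: induced_op_unit.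
have UPu : U *m P \in unitmx by rewrite unitmx_mul Uu.
apply: (@sov_of_eigenbasis R dim (U *m P) UPu N _ c (@zeros R N d eta xi) c0).
- move=> t a.
  have colU : col a (U *m P) = U *m col a P by rewrite !colE mulmxA.
  have -> : (aux dim V *m bulk d eta xi (sites N) t *m aux dim W) i j =
      c *: (aux dim (invmx W') *m bulk d eta xi (sites N) t *m aux dim W') 1 1.
    rewrite !aux_conjE scaler_sumr; apply: eq_bigr => k _.
    rewrite scaler_sumr; apply: eq_bigr => l _; rewrite scalerA V'E !mxE /=.
    congr (_ *: _); rewrite mulrA mulrA mulfV // mul1r.
    by have [->|->] := ord2_eq k; have [->|->] := ord2_eq l.
  rewrite -scalemxAl colU mulmxA -bulk_rotationE // -mulmxA eigP.
  by rewrite -scalemxAr scalerA.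
- by move=> a b; apply: zeros_simple.
Qed.

Lemma monodromy_entry (K : 'M[C]_2) lam i j : monodromy d eta xi K lam i j =
  (aux dim K *m bulk d eta xi (sites N) lam *m aux dim 1%:M) i j.
Proof. by rewrite monodromy_bulk aux1 mulmx1. Qed.

Lemma sov_monodromy_entry (K : 'M[C]_2) i j : K i j != 0 ->
  sklyanin_sov N (fun lam => monodromy d eta xi K lam i j).
Proof.
move=> Kij; have := @sov_matrix_element K 1%:M i j.
rewrite mulmx1 => /(_ Kij); congr sklyanin_sov.
by apply: funext => lam; rewrite monodromy_entry.
Qed.

Variables (W K : 'M[C]_2).
Hypothesis Wu : W \in unitmx.

(** Cyclicity of the trace, valid here because the matrix moved around, W, has scalar entries. *)
Lemma rotated_op_delta lam i j :
  rotated_op d eta xi W (delta_mx j i) K lam =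
  (aux dim (invmx W *m K) *m bulk d eta xi (sites N) lam *m aux dim W) i j.
Proof.
rewrite /rotated_op monodromy_bulk mulmxA -!auxM aux_conjE exchange_big /mxtrace.
apply: eq_bigr => b _; rewrite aux_mulE; apply: eq_bigr => a _.
by rewrite -mulmxA mul_delta_mxE mulrC.
Qed.

(** Write W^-1 K M W as (W^-1 K W)(W^-1 M W): the second factor is M conjugated by the induced
    operator, which commutes with the scalars of the first. *)
Lemma rotated_op_conj lam i j :
  rotated_op d eta xi W (delta_mx j i) K lam =
  induced_op d W *m monodromy d eta xi (invmx W *m K *m W) lam i j *m
    invmx (induced_op d W).
Proof.
rewrite rotated_op_delta; apply: (canRL (mulmxK (induced_op_unit d Wu))).
rewrite monodromy_bulk -[in LHS](mulmxK Wu (invmx W *m K)).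
rewrite auxM -[aux dim _ *m _ *m _ *m _]mulmxA -[aux dim _ *m _ *m _]mulmxA.
rewrite [aux dim (invmx W) *m _]mulmxA !aux_mulE mulmx_suml mulmx_sumr.
by apply: eq_bigr => a _; rewrite -scalemxAl -scalemxAr bulk_rotationE.
Qed.

Lemma sov_rotated_op i j : (invmx W *m K *m W) i j != 0 ->
  sklyanin_sov N (rotated_op d eta xi W (delta_mx j i) K).
Proof.
move=> nz; have := @sov_matrix_element (invmx W *m K) W i j nz; congr sklyanin_sov.
by apply: funext => lam; rewrite rotated_op_delta.
Qed.

End SeparationOfVariables.

Theorem theorem3p1 (R : realType) (N : nat) (d : 'I_N -> nat) (eta : R[i])
    (xi : 'I_N -> R[i]) (K : 'M[R[i]]_2)
    (hN : (0 < N)%N)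
    (hd : forall n, (0 < d n)%N)
    (heta : eta != 0)
    (hxi : forall i j, i != j -> neq_mod eta (xi i) (xi j))
    (hxi_mixed : mixed_spins_generic d eta xi)
    (hK : ~~ is_scalar_mx K) :
  [/\ (K 0 1 != 0 -> sklyanin_sov N (B_op d eta xi K)) /\
      (K 1 0 != 0 -> sklyanin_sov N (C_op d eta xi K)),
      K 0 1 = 0 ->
        (exists W, admissible_rotation K W) /\
        forall W, admissible_rotation K W ->
          (forall lam, Btilde_op d eta xi W K lam =
             induced_op d W *m B_op d eta xi (invmx W *m K *m W) lam *m
               invmx (induced_op d W)) /\
          sklyanin_sov N (Btilde_op d eta xi W K)
    & K 1 0 = 0 ->
        (exists W, admissible_rotation K W) /\
        forall W, admissible_rotation K W ->
          (forall lam, Ctilde_op d eta xi W K lam =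
             induced_op d W *m C_op d eta xi (invmx W *m K *m W) lam *m
               invmx (induced_op d W)) /\
          sklyanin_sov N (Ctilde_op d eta xi W K)].
Proof.
have eB : mx22 0 0 1 0 = delta_mx 1 0 :> 'M[R[i]]_2 by apply: eq_mx22; rewrite !mxE.
have eC : mx22 0 1 0 0 = delta_mx 0 1 :> 'M[R[i]]_2 by apply: eq_mx22; rewrite !mxE.
have rot := exists_admissible_rotation hK.
split.
- split=> nz; exact: (sov_monodromy_entry heta hxi hxi_mixed nz).
- move=> _; split=> // W [Wu K01 _].
  rewrite /Btilde_op eB; split=> [lam|]; first exact: rotated_op_conj.
  exact: (sov_rotated_op heta hxi hxi_mixed K01).
- move=> _; split=> // W [Wu _ K10].
  rewrite /Ctilde_op eC; split=> [lam|]; first exact: rotated_op_conj.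
  exact: (sov_rotated_op heta hxi hxi_mixed K10).
Qed.
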